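(* Let $\hat x_0\in\mathbb R^d$ be any given solution (not necessarily feasible), let $k=(k_j)_{j=1,\ldots,l}\in\mathbb R^l$ be a vector with positive entries, and let $\rho$ be the $(1-\epsilon)$-quantile of $$\max_{j=1,\ldots,l}\frac{g_j(\hat x_0;\xi)-b_j}{k_j}$$ under $\xi\sim P$. Let $\hat x$ be an optimal solution of the reconstructed robust optimization problem $$\text{minimize } f(x)\ \text{ subject to }\ g(x;\xi)\le b\ \ \forall\,\xi:\ g(\hat x_0;\xi)\le b+\rho k .$$ Then $\hat x$ is feasible for the chance-constrained program $$\text{minimize } f(x)\ \text{ subject to }\ P(g(x;\xi)\le b)\ge 1-\epsilon .$$ Moreover, if $\hat x_0$ is feasible for this chance-constrained program, then $f(\hat x)\le f(\hat x_0)$.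
   Context: $\epsilon\in(0,1)$; $x\in\mathbb R^d$ is the decision vector, $f$ a real-valued objective, $\xi\in\mathbb R^m$ a random vector with distribution $P$, $g(x;\xi)=(g_j(x;\xi))_{j=1,\ldots,l}\in\mathbb R^l$, and $b=(b_j)_{j=1,\ldots,l}\in\mathbb R^l$. Vector inequalities are componentwise. The $(1-\epsilon)$-quantile of a real random variable $Y$ is $\inf\{y: P(Y\le y)\ge 1-\epsilon\}$. *)

(* Defs.v *)
From HB Require Import structures.
From mathcomp Require Import all_boot all_order all_algebra.
From mathcomp Require Import all_classical all_reals all_analysis.

Set Implicit Arguments.
Unset Strict Implicit.
Unset Printing Implicit Defensive.

Import Order.TTheory GRing.Theory Num.Theory.

Local Open Scope classical_set_scope.
Local Open Scope ring_scope.

(* MathComp puts no componentwise order on matrices. *)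
Definition vec_le (R : realType) (n : nat) (u v : 'rV[R]_n) : Prop :=
  forall j, u ord0 j <= v ord0 j.

(* The p-quantile; for Y measurable and 0 < p < 1 the set is nonempty and
   bounded below, so the real-valued [inf] is the genuine infimum. *)
Definition quantile (R : realType) (disp : measure_display)
    (T : measurableType disp) (P : probability T R) (Y : T -> R) (p : R) : R :=
  inf [set y : R | (p%:E <= P [set t | (Y t <= y)%R])%E].

Definition optimal_solution (R : realType) (X : Type) (f : X -> R)
    (S : set X) (x : X) : Prop :=
  S x /\ forall y, S y -> f x <= f y.

(* In the following definitions the uncertainty lives in R^m, represented by
   [m.-tuple R] because this type carries the product of the Borel
   sigma-algebras of R; [P] is the distribution of the random vector. *)

Definition chance_feasible (R : realType) (d m l : nat)
    (P : probability (m.-tuple R) R)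
    (g : 'rV[R]_d -> m.-tuple R -> 'rV[R]_l) (b : 'rV[R]_l) (eps : R)
    : set 'rV[R]_d :=
  [set x | ((1 - eps)%:E <= P [set xi | vec_le (g x xi) b])%E].

Definition robust_feasible (R : realType) (d m l : nat)
    (g : 'rV[R]_d -> m.-tuple R -> 'rV[R]_l) (b : 'rV[R]_l)
    (U : set (m.-tuple R)) : set 'rV[R]_d :=
  [set x | forall xi, U xi -> vec_le (g x xi) b].

(* The number of constraints is [l.+1] so that the maximum is over a nonempty
   index set; the seed of the iterated maximum is its first term. *)
Definition max_scaled_violation (R : realType) (d m l : nat)
    (g : 'rV[R]_d -> m.-tuple R -> 'rV[R]_l.+1) (b k : 'rV[R]_l.+1)
    (x0 : 'rV[R]_d) (xi : m.-tuple R) : R :=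
  let ratio j := (g x0 xi ord0 j - b ord0 j) / k ord0 j in
  \big[Num.max/ratio ord0]_(j < l.+1) ratio j.

Definition reconstructed_uncertainty_set (R : realType) (d m l : nat)
    (g : 'rV[R]_d -> m.-tuple R -> 'rV[R]_l) (b k : 'rV[R]_l)
    (x0 : 'rV[R]_d) (rho : R) : set (m.-tuple R) :=
  [set xi | vec_le (g x0 xi) (b + rho *: k)].

(* Main.v *)
Require Import Defs.
From HB Require Import structures.
From mathcomp Require Import all_boot all_order all_algebra.
From mathcomp Require Import all_classical all_reals all_analysis measurable_realfun.

Set Implicit Arguments.
Unset Strict Implicit.
Unset Printing Implicit Defensive.

Import Order.TTheory GRing.Theory Num.Theory.

Local Open Scope classical_set_scope.
Local Open Scope ring_scope.

(** Write Y for the worst scaled violation at the initial solution.  Since every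
    k_j is positive, an outcome satisfies g(x0; xi) <= b + r k exactly when
    Y xi <= r ([max_scaled_violation_leP]).  The reconstructed uncertainty set
    is therefore the event Y <= rho, and the constraints g(x0; xi) <= b are
    the event Y <= 0; both halves of the theorem are facts about the quantile
    rho of Y.

    Feasibility: the infimum defining a quantile is attained, because a
    distribution function is right-continuous ([quantile_attained]), so the
    uncertainty set has probability at least 1 - eps.  A robust feasible
    solution meets its constraints on that whole set, hence with at least that
    probability.

    Improvement: if x0 is feasible for the chance constraint, then 0 is one of
    the levels over which the infimum is taken, so rho <= 0
    ([quantile_le]).  On the uncertainty set this gives
    g(x0; xi) <= b + rho k <= b: x0 competes in the robust problem, and the
    optimum is at least as good. *)

Section Quantile.
Context (R : realType) (disp : measure_display) (T : measurableType disp).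
Variables (P : probability T R) (Y : T -> R) (p : R).
Hypothesis mY : measurable_fun setT Y.
Hypothesis p01 : 0 < p < 1.

Let levels := [set y : R | (p%:E <= P [set t | (Y t <= y)%R])%E].

Let X : {RV P >-> R} := mfun_Sub (mem_set mY).

Let cdfE y : cdf X y = P [set t | Y t <= y].
Proof. by []. Qed.

(** The two limits of the distribution function, 1 at +oo and 0 at -oo, are
    what keep the infimum of the levels from being a default value. *)
Let has_inf_levels : has_inf levels.
Proof.
have /andP[p0 p1] := p01.
split; apply: contrapT => levelsN.
- have : (1 <= p%:E)%E.
    apply: cvge_le (cvg_cdfy1 X); apply: nearW => y.
    rewrite cdfE leNgt; apply/negP => /ltW py.
    by apply: levelsN; exists y.
  by rewrite lee_fin leNgt p1.
- have : (p%:E <= 0)%E.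
    apply: cvge_ge (cvg_cdfNy0 X); apply: nearW => y.
    rewrite leNgt; apply/negP => cdf_lt; apply: levelsN; exists y => z /= pz.
    rewrite leNgt; apply/negP => /ltW /(cdf_nondecreasing X) cdf_zy.
    by have := lt_le_trans cdf_lt (le_trans pz cdf_zy); rewrite ltxx.
  by rewrite lee_fin leNgt p0.
Qed.

Lemma quantile_le y : (p%:E <= P [set t | (Y t <= y)%R])%E ->
  quantile P Y p <= y.
Proof. by move=> py; apply: ge_inf => //; exact: has_inf_levels.2. Qed.

(** Every point to the right of the infimum lies above some level, so the
    distribution function is at least p there; right-continuity passes this
    bound to the infimum itself. *)
Lemma quantile_attained :
  (p%:E <= P [set t | (Y t <= quantile P Y p)%R])%E.
Proof.
rewrite -cdfE.
apply: cvge_ge (@cdf_right_continuous _ _ _ P X (quantile P Y p)).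
near=> y.
have qy : quantile P Y p < y by near: y; exact: nbhs_right_gt.
have [||z pz zy] := @inf_adherent _ levels (y - quantile P Y p).
- by rewrite subr_gt0.
- exact: has_inf_levels.
- apply: le_trans (cdf_nondecreasing X (ltW _)); first by rewrite cdfE; exact: pz.
  by rewrite addrC subrK in zy.
Unshelve. all: by end_near. Qed.

End Quantile.

Lemma measurable_fun_bigmaxr (R : realType) (disp : measure_display)
    (T : measurableType disp) (I : Type) (s : seq I) (f : T -> R)
    (F : I -> T -> R) :
  measurable_fun setT f -> (forall i, measurable_fun setT (F i)) ->
  measurable_fun setT (fun t => \big[Num.max/f t]_(i <- s) F i t).
Proof.
move=> mf mF; elim: s => [|i s IHs].
  by under eq_fun do rewrite big_nil.
by under eq_fun do rewrite big_cons; exact: measurable_maxr.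
Qed.

Section ScaledViolation.
Context (R : realType) (d m l : nat).
Variables (g : 'rV[R]_d -> m.-tuple R -> 'rV[R]_l.+1) (b k : 'rV[R]_l.+1).

Lemma max_scaled_violation_leP x xi r : (forall j, 0 < k ord0 j) ->
  max_scaled_violation g b k x xi <= r <-> vec_le (g x xi) (b + r *: k).
Proof.
move=> k_gt0.
have ratio_le j :
    ((g x xi ord0 j - b ord0 j) / k ord0 j <= r) =
    (g x xi ord0 j <= (b + r *: k) ord0 j).
  by rewrite !mxE ler_pdivrMr// lerBlDl.
rewrite /max_scaled_violation; split => [/bigmax_leP[_ le_r] j|le_r].
  by rewrite -ratio_le le_r.
by apply/bigmax_leP; split => [|j _]; rewrite ratio_le.
Qed.

Hypothesis mg : forall x j, measurable_fun setT (fun xi => g x xi ord0 j).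

Lemma measurable_max_scaled_violation x :
  measurable_fun setT (max_scaled_violation g b k x).
Proof.
have mratio j :
    measurable_fun setT (fun xi => (g x xi ord0 j - b ord0 j) / k ord0 j).
  by apply: measurable_funM => //; exact: measurable_funB.
exact: measurable_fun_bigmaxr.
Qed.

Lemma measurable_vec_le x (v : 'rV[R]_l.+1) :
  measurable [set xi | vec_le (g x xi) v].
Proof.
rewrite (_ : [set xi | _] = \bigcap_(j in [set: 'I_l.+1])
    (setT `&` (fun xi => g x xi ord0 j) @^-1` `]-oo, v ord0 j])).
  apply: fin_bigcap_measurable => // j _.
  by apply: mg => //; exact: measurable_itv.
apply/seteqP; split => xi /= gv j.
  by move=> _; split => //=; rewrite in_itv/=.
by have [_ /=] := gv j I; rewrite in_itv.
Qed.

End ScaledViolation.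

Theorem theorem4 (R : realType) (d m l : nat) (eps : R)
    (heps : 0 < eps < 1)
    (P : probability (m.-tuple R) R)
    (f : 'rV[R]_d -> R)
    (g : 'rV[R]_d -> m.-tuple R -> 'rV[R]_l.+1)
    (hg : forall x j, measurable_fun setT (fun xi => g x xi ord0 j))
    (b k : 'rV[R]_l.+1) (hk : forall j, 0 < k ord0 j)
    (xhat0 xhat : 'rV[R]_d) (rho : R)
    (hrho : rho = quantile P (max_scaled_violation g b k xhat0) (1 - eps))
    (hxhat : optimal_solution f
       (robust_feasible g b (reconstructed_uncertainty_set g b k xhat0 rho))
       xhat) :
  chance_feasible P g b eps xhat /\
  (chance_feasible P g b eps xhat0 -> f xhat <= f xhat0).
Proof.
have mY := measurable_max_scaled_violation b k hg xhat0.
have p01 : 0 < 1 - eps < 1.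
  by case/andP: heps => e0 e1; rewrite subr_gt0 e1 ltrBlDr ltrDl e0.
have YleE r : [set xi | max_scaled_violation g b k xhat0 xi <= r] =
    [set xi | vec_le (g xhat0 xi) (b + r *: k)].
  by apply/seteqP; split => xi /= /max_scaled_violation_leP; apply.
have [xhat_robust xhat_min] := hxhat.
split => [|xhat0_feasible].
- rewrite /chance_feasible /=.
  apply: le_trans (quantile_attained P mY p01) _.
  rewrite -hrho YleE; apply: le_measure; rewrite ?inE.
  + exact: measurable_vec_le.
  + exact: measurable_vec_le.
  + exact: xhat_robust.
- have rho_le0 : rho <= 0.
    rewrite hrho; apply: quantile_le => //.
    by rewrite YleE scale0r addr0.
  apply: xhat_min => xi xi_U j; apply: le_trans (xi_U j) _.
  by rewrite !mxE gerDl mulr_le0_ge0// ltW.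
Qed.
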